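(* Let $f:\mathbb{R}^d\to(-\infty,\infty]$ be closed, convex, and proper, and let $L$ satisfy the standing assumptions on inexact smoothness functions. The following are equivalent: 1. $f(y)\ge f(x)+\langle g_x,y-x\rangle+\frac{1}{2L(\delta)}\|g_y-g_x\|^2-\delta$ for all $\delta\ge0$ and all $x,y$ with $g_x\in\partial f(x)$, $g_y\in\partial f(y)$; 2. $f$ is $L(\cdot)$-inexactly smooth; 3. the Fenchel conjugate $f^*$ is $1/L(\cdot)$-inexactly strongly convex.
   Context: Norms are Euclidean; $\partial$ is the convex subdifferential; $1/\infty=0$. Standing assumptions on $L:[0,\infty)\to(0,\infty]$: finite for all $\delta>0$, convex, lower semicontinuous, nonincreasing, with $-1/L(\cdot)$ convex. A convex $f$ is $L(\cdot)$-inexactly smooth if for all $x,y\in\mathbb{R}^d$, $g_x\in\partial f(x)$, $\delta\ge0$: $f(y)\le f(x)+\langle g_x,y-x\rangle+\frac{L(\delta)}2\|y-x\|^2+\delta$ (nothing is imposed when $L(\delta)=\infty$). A convex $h$ is $\mu(\cdot)$-inexactly strongly convex if for all $\delta\ge0$, all $x,y\in\mathbb{R}^d$ and $g_x\in\partial h(x)$: $h(y)\ge h(x)+\langle g_x,y-x\rangle+\frac{\mu(\delta)}2\|x-y\|^2-\delta$. $f^*(g)=\sup_x\{\langle g,x\rangle-f(x)\}$. *)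

(* Defs.v *)
From HB Require Import structures.
From mathcomp Require Import all_boot all_order all_algebra.
From mathcomp Require Import all_classical all_reals all_analysis.
Set Implicit Arguments.
Unset Strict Implicit.
Unset Printing Implicit Defensive.
Import Order.TTheory GRing.Theory Num.Theory.
Import numFieldNormedType.Exports.
Local Open Scope classical_set_scope.
Local Open Scope ring_scope.
Local Open Scope ereal_scope.

(* The library's norm on 'rV[R]_d is the max norm, so the Euclidean one is
   defined here; both induce the library's topology on 'rV[R]_d. *)
Definition dotp {R : realType} {d : nat} (u v : 'rV[R]_d) : R :=
  (\sum_(i < d) u ord0 i * v ord0 i)%R.

Definition enorm {R : realType} {d : nat} (u : 'rV[R]_d) : R :=
  Num.sqrt (dotp u u).

Definition epigraph {R : realType} {T : Type} (A : set T) (f : T -> \bar R)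
  : set (T * R^o) := [set p | A p.1 /\ f p.1 <= (p.2)%:E].

Definition convex_on {R : realType} {E : lmodType R} (A : set E)
    (f : E -> \bar R) : Prop :=
  convex_set (epigraph A f).

Definition closed_fun {R : realType} {d : nat} (f : 'rV[R]_d -> \bar R)
  : Prop := closed (epigraph setT f).

Definition proper_fun {R : realType} {T : Type} (f : T -> \bar R) : Prop :=
  (forall x, -oo < f x) /\ exists x, f x < +oo.

Definition subdifferential {R : realType} {d : nat} (f : 'rV[R]_d -> \bar R)
    (x : 'rV[R]_d) : set 'rV[R]_d :=
  [set g | forall y, f x + (dotp g (y - x)%R)%:E <= f y].

Definition fenchel_conjugate {R : realType} {d : nat}
    (f : 'rV[R]_d -> \bar R) (g : 'rV[R]_d) : \bar R :=
  ereal_sup (range (fun x => (dotp g x)%:E - f x)).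

(* A function [0, +oo) -> (0, +oo] is represented by a function on all of R
   whose values at negative arguments are irrelevant.  In \bar R the inverse
   satisfies +oo^-1 = 0.  Semicontinuity is relative to [0, +oo). *)
Record inexact_smoothness_function {R : realType} (L : R -> \bar R) : Prop := {
  isf_gt0 : forall delta : R, (0 <= delta)%R -> 0 < L delta;
  isf_finite : forall delta : R, (0 < delta)%R -> L delta < +oo;
  isf_convex : @convex_on R R^o `[0%R, +oo[ L;
  isf_lsc : @lower_semicontinuous (subspace (`[0%R, +oo[ : set R)) R L;
  isf_nonincreasing : forall delta1 delta2 : R,
    (0 <= delta1)%R -> (delta1 <= delta2)%R -> L delta2 <= L delta1;
  isf_convex_oppV : @convex_on R R^o `[0%R, +oo[ (fun delta => - (L delta)^-1)
}.

Definition inexactly_smooth {R : realType} {d : nat} (L : R -> \bar R)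
    (f : 'rV[R]_d -> \bar R) : Prop :=
  convex_on setT f /\
  forall (x y gx : 'rV[R]_d) (delta : R),
    subdifferential f x gx -> (0 <= delta)%R -> L delta < +oo ->
    f y <= f x + (dotp gx (y - x)%R)%:E
           + L delta / 2%:E * (enorm (y - x)%R ^+ 2)%:E + delta%:E.

Definition inexactly_strongly_convex {R : realType} {d : nat}
    (mu : R -> \bar R) (h : 'rV[R]_d -> \bar R) : Prop :=
  convex_on setT h /\
  forall (x y gx : 'rV[R]_d) (delta : R),
    subdifferential h x gx -> (0 <= delta)%R ->
    h x + (dotp gx (y - x)%R)%:E
      + mu delta / 2%:E * (enorm (x - y)%R ^+ 2)%:E - delta%:E <= h y.

(* Main.v *)
(** If [f - <g, .>] is bounded below, it has a proximal point [z] around any [a]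
    with any parameter [e > 0], so [g + e (a - z)] is a subgradient of [f] at [z].
    This one existence result (compactness of a slice of the epigraph) replaces
    separation theorems and relative interiors. Around [a = x] with [e = 1] it
    turns [x \in df*(g)] into [g \in df(x)]; around [a = x] with [e -> 0] it
    extends condition 1 from subgradients of [f] to all of dom [f*], giving 3;
    around [a = y] with [e -> oo] it bounds [f y], giving 2. Conversely, 2 yields
    1 by comparing the upper model at [y] with the lower model at [x] at the point
    [y - (gy - gx) / L(delta)], and 3 yields 1 by Fenchel-Young equality. *)

Require Import Defs.
From HB Require Import structures.
From mathcomp Require Import all_boot all_order all_algebra.
From mathcomp Require Import all_classical all_reals all_analysis.
From mathcomp Require Import ring lra.
Import Order.TTheory GRing.Theory Num.Theory.
Import numFieldNormedType.Exports.
Local Open Scope classical_set_scope.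
Local Open Scope ring_scope.
Local Open Scope ereal_scope.

(** * The Euclidean inner product *)

Section dotp_theory.
Context {R : realType} {d : nat}.
Implicit Types u v w : 'rV[R]_d.

Lemma dotpC u v : dotp u v = dotp v u.
Proof. by apply: eq_bigr => i _; rewrite mulrC. Qed.

Lemma dotpDl u v w : dotp (u + v)%R w = (dotp u w + dotp v w)%R.
Proof.
by rewrite /dotp -big_split/=; apply: eq_bigr => i _; rewrite mxE mulrDl.
Qed.

Lemma dotpZl (k : R) u v : dotp (k *: u)%R v = (k * dotp u v)%R.
Proof.
by rewrite /dotp mulr_sumr; apply: eq_bigr => i _; rewrite mxE mulrA.
Qed.

Lemma dotpNl u v : dotp (- u)%R v = (- dotp u v)%R.
Proof. by rewrite -scaleN1r dotpZl mulN1r. Qed.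

Lemma dotpDr u v w : dotp u (v + w)%R = (dotp u v + dotp u w)%R.
Proof. by rewrite dotpC dotpDl !(dotpC u). Qed.

Lemma dotpZr (k : R) u v : dotp u (k *: v)%R = (k * dotp u v)%R.
Proof. by rewrite dotpC dotpZl dotpC. Qed.

Lemma dotpNr u v : dotp u (- v)%R = (- dotp u v)%R.
Proof. by rewrite dotpC dotpNl dotpC. Qed.

Definition dotpE := (dotpDl, dotpDr, dotpNl, dotpNr, dotpZl, dotpZr).

Lemma sqr_coord_le_dotp u i : (u ord0 i ^+ 2 <= dotp u u)%R.
Proof.
rewrite /dotp (bigD1 i)//= -expr2 lerDl.
by apply: sumr_ge0 => j _; rewrite -expr2 sqr_ge0.
Qed.

Lemma dotp_ge0 u : (0 <= dotp u u)%R.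
Proof. by apply: sumr_ge0 => j _; rewrite -expr2 sqr_ge0. Qed.

Lemma dotp_eq0 u : (dotp u u <= 0)%R -> u = 0%R.
Proof.
move=> u0; apply/rowP => i; rewrite mxE; apply/eqP.
by rewrite -sqrf_eq0 eq_le sqr_ge0 (le_trans (sqr_coord_le_dotp u i)).
Qed.

Lemma dotp_subZ u v (s : R) : dotp (u - s *: v)%R (u - s *: v)%R =
  (dotp u u + s ^+ 2 * dotp v v - 2 * s * dotp u v)%R.
Proof. by rewrite !dotpE (dotpC v u); ring. Qed.

Lemma dotp_mul2_le u v : (2 * dotp u v <= dotp u u + dotp v v)%R.
Proof. by have := dotp_ge0 (u - v)%R; rewrite !dotpE (dotpC v u); lra. Qed.

Lemma enorm_sqr u : (enorm u ^+ 2)%R = dotp u u.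
Proof. by rewrite /enorm sqr_sqrtr// dotp_ge0. Qed.

Lemma continuous_dotp (T : topologicalType) (u v : T -> 'rV[R]_d) :
  continuous u -> continuous v -> continuous (fun x => dotp (u x) (v x)).
Proof.
move=> cu cv; rewrite /dotp; apply: continuous_big => [|i _ x].
  by move=> p; exact: add_continuous.
by apply: cvgM; (apply: (cvg_comp _ (fun M : 'rV[R]_d => M ord0 i));
  [|exact: coord_continuous]); [exact: cu|exact: cv].
Qed.

End dotp_theory.

(** Letting [s] tend to [0] discards an error of first order in [s]. *)
Lemma ge0_lim (R : realType) (a b : R) :
  (forall s : R, 0 < s -> s < 1 -> 0 <= a + s * b)%R -> (0 <= a)%R.
Proof.
move=> H; rewrite leNgt; apply/negP => a0.
(* If [a < 0], this [s] lies in []0, 1[] and gives [a + s |b| = - s (1 + |b| - a) < 0]. *)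
pose s := (- a / (1 + 2 * `|b| - a))%R.
have b0 := normr_ge0 b; have bb := ler_norm b.
have D0 : (0 < 1 + 2 * `|b| - a)%R by lra.
have s0 : (0 < s)%R by rewrite divr_gt0// oppr_gt0.
have s1 : (s < 1)%R by rewrite ltr_pdivrMr//; lra.
have sE : (s * (1 + 2 * `|b| - a) = - a)%R by rewrite divfK// gt_eqF.
have := H _ s0 s1; apply/negP; rewrite -ltNge.
have : (s * b <= s * `|b|)%R by rewrite ler_pM2l.
have : (s * a < 0)%R by rewrite pmulr_rlt0.
have : (0 <= s * `|b|)%R by rewrite mulr_ge0// ltW.
nra.
Qed.

(** * Closed convex functions and their proximal points *)

Section convex_functions.
Context {R : realType} {d : nat}.
Implicit Types (f : 'rV[R]_d -> \bar R) (x y z g : 'rV[R]_d).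

Lemma convex_on_le f x y (a b t : R) : convex_on setT f ->
  (0 <= t <= 1)%R -> f x <= a%:E -> f y <= b%:E ->
  f (t *: x + (1 - t) *: y)%R <= (t * a + (1 - t) * b)%:E.
Proof.
move=> cf /andP[t0 t1] fx fy.
have := cf (x, a) (y, b) (Itv01 t0 t1); rewrite !inE => /(_ _ _)/=.
by case=> //=.
Qed.

Lemma subdifferential_fin f x g : proper_fun f -> subdifferential f x g ->
  exists r : R, f x = r%:E.
Proof.
move=> [fNy [z fz]] /(_ z); have := fNy x.
case: (f x) => [r||]//; first by exists r.
by move=> _; rewrite addye// leye_eq => /eqP fzy; rewrite fzy ltxx in fz.
Qed.

Lemma subdifferentialP f x g (r : R) y : f x = r%:E -> subdifferential f x g ->
  (r + dotp g (y - x)%R)%:E <= f y.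
Proof. by move=> fx /(_ y); rewrite fx. Qed.

(** The set is the preimage of the epigraph under a continuous map. A general [T] serves both points
    and pairs of point and height. *)
Lemma closed_fun_affine f g (T : topologicalType) (z : T -> 'rV[R]_d)
    (u : T -> R) : closed_fun f -> continuous z -> continuous u ->
  closed [set p | f (z p) <= (u p + dotp g (z p))%:E].
Proof.
move=> cf cz cu.
rewrite (_ : [set p | _] =
  (fun p => (z p, u p + dotp g (z p))%R) @^-1` epigraph setT f); last first.
  by apply/seteqP; split => p /=; [split|case].
apply: preimage_closed => // p _.
apply: (@cvg_pair _ _ _ _ (nbhs (z p)) (nbhs (u p + dotp g (z p))%R)).
  exact: cz.
apply: cvgD; first exact: cu.
by apply: (@continuous_dotp _ _ _ (fun=> g)) => // q; exact: cvg_cst.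
Qed.

Lemma closed_fun_limit f g y (b : R) : closed_fun f ->
  (forall e : R, (0 < e)%R -> exists z, (dotp (y - z)%R (y - z)%R <= e)%R /\
     f z <= (b + dotp g (z - y)%R)%:E) ->
  f y <= b%:E.
Proof.
move=> cf H.
have cA := @closed_fun_affine f g _ id (fun=> b - dotp g y)%R cf
  (fun x => @cvg_id _ _) (fun x => @cvg_cst _ _ _ _ _).
suff : [set z | f z <= (b - dotp g y + dotp g z)%:E] y by rewrite /= subrK.
apply: cA => B /nbhs_ballP[e /= e0 eB].
(* Each coordinate of [y - z] is then at most [e / 2 < e], which puts [z] in the max-norm ball. *)
have [|z [yz fz]] := H ((e / 2) ^+ 2)%R; first by rewrite exprn_gt0// divr_gt0.
exists z; split; first by move: fz; rewrite !dotpE/= addrA addrAC.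
apply: eB; split => // i j; rewrite ord1 /ball/=.
have := le_trans (sqr_coord_le_dotp _ j) yz; rewrite !mxE.
rewrite -[X in (X <= _)%R]real_normK ?num_real//.
rewrite ler_pXn2r ?nnegrE ?divr_ge0 ?(ltW e0)// => H1.
by apply: le_lt_trans H1 _; rewrite ltr_pdivrMr// ltr_pMr// ltr1n.
Qed.

(** Minimizing over pairs of a point and a height in the epigraph of [f - <g, .>] makes the
    objective [phi] continuous and real-valued, although [f] itself need be neither. Heights are at
    least [m], so a sublevel set of [phi] lies in a compact box. *)
Lemma prox_minimizer f g a (m e : R) : closed_fun f -> proper_fun f ->
  (0 < e)%R -> (forall x, (m + dotp g x)%:E <= f x) ->
  exists z (r : R), f z = r%:E /\ forall x (t : R), f x <= t%:E ->
    (r - dotp g z + e / 2 * dotp (z - a)%R (z - a)%R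
     <= t - dotp g x + e / 2 * dotp (x - a)%R (x - a)%R)%R.
Proof.
move=> cf [fNy [x0 fx0]] e0 fm.
have [t0 ft0] : exists t0 : R, f x0 = t0%:E.
  by move: (fNy x0) fx0; case: (f x0) => // t0 _ _; exists t0.
pose phi (p : 'rV[R]_d * R) := (p.2 + e / 2 * dotp (p.1 - a) (p.1 - a))%R.
pose E := [set p : 'rV[R]_d * R | f p.1 <= (p.2 + dotp g p.1)%:E].
pose c := phi (x0, t0 - dotp g x0)%R.
(* On the sublevel set [|x - a|^2 <= rho - 1]; since [|t| <= t^2 + 1], each coordinate of [x - a] is
   bounded by [rho] without a square root. *)
pose rho := (1 + 2 * (c - m) / e)%R.
pose I (i : 'I_d) : set R := `[(a ord0 i - rho)%R, (a ord0 i + rho)%R]%classic.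
pose B := [set v : 'rV[R]_d | forall i, I i (v ord0 i)] `*` `[m, c]%classic.
have E0 : E (x0, t0 - dotp g x0)%R by rewrite /E/= subrK ft0.
have EB p : E p -> (phi p <= c)%R -> B p.
  case: p => x u; rewrite /E/= => Ep phip.
  have mu : (m <= u)%R.
    by have := le_trans (fm x) Ep; rewrite lee_fin lerD2r.
  have dd := dotp_ge0 (x - a)%R.
  have de : (e * dotp (x - a)%R (x - a)%R <= 2 * (c - m))%R.
    by move: phip; rewrite /phi/=; lra.
  split => /=; last first.
    rewrite in_itv/= mu/=; apply: le_trans phip; rewrite /phi/= lerDl.
    by rewrite mulr_ge0// divr_ge0// ltW.
  move=> i; rewrite /I/= in_itv/=.
  have := sqr_coord_le_dotp (x - a)%R i; rewrite !mxE => si.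
  have : (dotp (x - a)%R (x - a)%R <= rho - 1)%R.
    by rewrite /rho [(1 + _)%R]addrC addrK ler_pdivlMr// mulrC.
  nra.
have cE : closed E.
  apply: (@closed_fun_affine f g _ fst snd) => // p;
    [exact: cvg_fst|exact: cvg_snd].
have kB : compact B.
  apply: compact_setX; last exact: segment_compact.
  by apply: (@rV_compact _ _ I) => i; exact: segment_compact.
have cw : continuous (fun p : 'rV[R]_d * R => p.1 - a)%R.
  by move=> p; apply: cvgB; [exact: cvg_fst|exact: cvg_cst].
have cphi : continuous phi.
  move=> p; apply: cvgD; first exact: cvg_snd.
  apply: cvgM; first exact: cvg_cst.
  exact: (continuous_dotp _ _ _ cw cw p).
have [||p|[z u]] := @compact_EVT_min _ _ phi (B `&` E).
- by exists (x0, t0 - dotp g x0)%R; split => //; apply: EB.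
- exact: compact_closedI.
- exact: continuous_subspaceT.
rewrite inE => -[Bz Ez] zmin.
have phimin p : E p -> (phi (z, u) <= phi p)%R.
  move=> Ep; have [pc|/ltW cp] := leP (phi p) c.
    by apply: zmin; rewrite inE; split => //; exact: EB.
  apply: le_trans cp; apply: zmin; rewrite inE; split => //; exact: EB.
have [r fz] : exists r : R, f z = r%:E.
  by move: (fNy z) Ez; rewrite /E/=; case: (f z) => // r _ _; exists r.
exists z, r; split => // x t fx.
have := phimin (x, t - dotp g x)%R; rewrite /E/phi/= subrK => /(_ fx).
apply: le_trans; rewrite lerD2r lerBlDr.
by move: Ez; rewrite /E/= fz lee_fin.
Qed.

(* [z] is the proximal point of [a] for [f - <g, .>]; the conclusion is its
   first-order optimality condition. *)
Lemma prox f g a (m e : R) : closed_fun f -> convex_on setT f ->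
  proper_fun f -> (0 < e)%R -> (forall x, (m + dotp g x)%:E <= f x) ->
  exists z, subdifferential f z (g + e *: (a - z))%R.
Proof.
move=> cf vf pf e0 fm.
have [z [r [fz zmin]]] := prox_minimizer f g a m e cf pf e0 fm.
exists z => y; rewrite fz.
case fy : (f y) => [s||]; last 2 first.
- by rewrite leey.
- by have := pf.1 y; rewrite fy ltxx.
rewrite -EFinD lee_fin -subr_ge0.
(* Comparing [z] with [t y + (1 - t) z] and dividing by [t] gives the subgradient inequality up to
   the error [t e / 2 |y - z|^2]. *)
apply: (@ge0_lim _ _ (e / 2 * dotp (y - z) (y - z))%R) => t t0 t1.
have t01 : (0 <= t <= 1)%R by rewrite !ltW.
have := convex_on_le f y z s r t vf t01.
rewrite fz fy => /(_ (lexx _) (lexx _)) /zmin.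
rewrite -(pmulr_rge0 _ t0) -subr_ge0; congr (0 <= _)%R.
by rewrite !dotpE ?(dotpC z y) ?(dotpC a y) ?(dotpC a z); field.
Qed.

End convex_functions.

(** * The Fenchel conjugate and its subgradients *)

Section conjugate.
Context {R : realType} {d : nat}.
Implicit Types (f : 'rV[R]_d -> \bar R) (x y z g h : 'rV[R]_d).

Lemma fenchel_young f g x : (dotp g x)%:E - f x <= fenchel_conjugate f g.
Proof. by apply: ereal_sup_ubound; exists x. Qed.

Lemma conjugate_gtNy f g : proper_fun f -> -oo < fenchel_conjugate f g.
Proof.
move=> [fNy [x]]; have := fNy x; case fx : (f x) => [r||]// _ _.
by apply: lt_le_trans (fenchel_young f g x); rewrite fx -EFinB ltNyr.
Qed.

(** A finite conjugate value supplies the affine lower bound that [prox] asks for. *)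
Lemma conjugate_minorant f g (c : R) : fenchel_conjugate f g <= c%:E ->
  forall x, (- c + dotp g x)%:E <= f x.
Proof.
move=> fg x; have := le_trans (fenchel_young f g x) fg.
case: (f x) => [r||]//; last by move=> _; exact: leey.
by rewrite -EFinB !lee_fin; lra.
Qed.

(** Fenchel-Young equality: the subgradient inequality says that [x] attains the supremum. *)
Lemma conjugate_subdifferential f g x (r : R) : f x = r%:E ->
  subdifferential f x g -> fenchel_conjugate f g = (dotp g x - r)%:E.
Proof.
move=> fx sx; apply/eqP; rewrite eq_le; apply/andP; split; last first.
  by apply: le_trans (fenchel_young f g x); rewrite fx.
apply: ge_ereal_sup => _ [y _ <-].
have := subdifferentialP f x g r y fx sx.
case: (f y) => [s||]//; last by rewrite /= leNye.
by rewrite -EFinB !lee_fin !dotpE; lra.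
Qed.

Lemma subdifferential_conjugate f g x (r : R) : f x = r%:E ->
  subdifferential f x g -> subdifferential (fenchel_conjugate f) g x.
Proof.
move=> fx sx h; rewrite (conjugate_subdifferential f g x r)//.
apply: le_trans (fenchel_young f h x); rewrite fx -EFinD -EFinB lee_fin !dotpE.
by rewrite ?(dotpC x); lra.
Qed.

(* The proximal point [z] of [x] satisfies [g + (x - z) \in df(z)], and the
   subgradient inequality of the conjugate at [g] reads [0 <= - |x - z|^2]. *)
Lemma conjugate_subdifferentialK f g x (c : R) : closed_fun f ->
  convex_on setT f -> proper_fun f -> fenchel_conjugate f g = c%:E ->
  subdifferential (fenchel_conjugate f) g x -> subdifferential f x g.
Proof.
move=> cf vf pf fg sg.
have fm : forall y, (- c + dotp g y)%:E <= f y.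
  by apply: conjugate_minorant; rewrite fg.
have [z sz] := prox f g x (- c)%R 1%R cf vf pf ltr01 fm.
have [r fz] := subdifferential_fin f z _ pf sz.
suff xz : (x - z = 0)%R by move: sz; rewrite xz scaler0 addr0 -(subr0_eq xz).
apply: dotp_eq0.
have := subdifferentialP _ g x c (g + 1 *: (x - z))%R fg sg.
rewrite (conjugate_subdifferential f _ z r fz sz) lee_fin.
have := fm z; rewrite fz lee_fin.
by rewrite !dotpE ?(dotpC x g) ?(dotpC z g) ?(dotpC z x); lra.
Qed.

Lemma convex_conjugate f : proper_fun f -> convex_on setT (fenchel_conjugate f).
Proof.
move=> pf [g a] [h b] t; rewrite !inE => -[_ /= ga] [_ /= hb]; split => //=.
apply: ge_ereal_sup => _ [x _ <-].
have t0 : (0 <= t%:num)%R by [].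
have t1 : (0 <= 1 - t%:num)%R by rewrite subr_ge0.
have := conjugate_minorant f g a ga x; have := conjugate_minorant f h b hb x.
have := pf.1 x; case: (f x) => [s||]//= _; last by rewrite leNye.
rewrite -EFinB !lee_fin !dotpE => H1 H2.
have : (0 <= t%:num * (s + a - dotp g x))%R by rewrite mulr_ge0//; lra.
have : (0 <= (1 - t%:num) * (s + b - dotp h x))%R by rewrite mulr_ge0//; lra.
by rewrite /GRing.scale/= /unstable.onem; lra.
Qed.

End conjugate.

(** * Smoothness, cocoercivity and strong convexity at a fixed [delta] *)

Section smoothness.
Context {R : realType} {d : nat}.
Implicit Types (f : 'rV[R]_d -> \bar R) (x y z g h : 'rV[R]_d).

(** One real [q] stands for the coefficients of conditions 1 and 3, so that the case [l = +oo] is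
    treated once. *)
Lemma inv_smoothness_fin (l : \bar R) : 0 < l ->
  exists q : R, [/\ (0 <= q)%R, (2%:E * l)^-1 = q%:E, l^-1 / 2%:E = q%:E &
    l < +oo -> exists k : R, [/\ l = k%:E, (0 < k)%R & q = (2 * k)^-1%R]].
Proof.
case: l => [k||]// k0.
- rewrite lte_fin in k0.
  exists (2 * k)^-1%R; split; first by rewrite invr_ge0 mulr_ge0// ltW.
  + by rewrite -EFinM inver mulf_eq0 pnatr_eq0/= gt_eqF.
  + rewrite !inver gt_eqF// pnatr_eq0/= -EFinM; congr _%:E.
    by rewrite invfM mulrC.
  + by move=> _; exists k.
- exists 0%R; split=> //.
  + by rewrite gt0_muley ?lte_fin// invey.
  + by rewrite invey mul0e.
Qed.

(* Condition 1 at a fixed [delta], with [q = 1 / (2 L(delta))], hence [q = 0] when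
   [L(delta) = +oo]. *)
Definition cocoercive f (q delta : R) := forall x y gx gy (r s : R),
  f x = r%:E -> f y = s%:E -> subdifferential f x gx ->
  subdifferential f y gy ->
  (r + dotp gx (y - x) + q * dotp (gy - gx) (gy - gx) - delta <= s)%R.

Lemma smooth_cocoercive f (k delta : R) : proper_fun f -> (0 < k)%R ->
  (forall x y g (r : R), f x = r%:E -> subdifferential f x g ->
    f y <= (r + dotp g (y - x) + k / 2 * dotp (y - x) (y - x) + delta)%:E) ->
  cocoercive f (2 * k)^-1 delta.
Proof.
move=> pf k0 H x y gx gy r s fx fy sx sy.
(* This point minimizes the upper model at [y] minus the lower model at [x]. *)
pose z := (y - k^-1 *: (gy - gx))%R.
have := le_trans (subdifferentialP f x gx r z fx sx) (H y z gy s fy sy).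
rewrite lee_fin /z -subr_ge0 -(subr_ge0 _ s); congr (0 <= _)%R.
rewrite !dotpE ?(dotpC y) ?(dotpC gy gx) ?(dotpC x); field.
by rewrite gt_eqF.
Qed.

(** Since [y] may have no subgradient, the bound is proved at proximal points [z] close to [y] and
    carried to [y] by closedness. *)
Lemma cocoercive_smooth f (k delta : R) x y g (r : R) : closed_fun f ->
  convex_on setT f -> proper_fun f -> (0 < k)%R -> (0 <= delta)%R ->
  cocoercive f (2 * k)^-1 delta -> f x = r%:E -> subdifferential f x g ->
  f y <= (r + dotp g (y - x) + k / 2 * dotp (y - x) (y - x) + delta)%:E.
Proof.
move=> cf vf pf k0 d0 H fx sx.
set B := (r + _ + _ + _)%R.
have fm : forall z, (r - dotp g x + dotp g z)%:E <= f z.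
  move=> z; apply: le_trans (subdifferentialP f x g r z fx sx).
  by rewrite lee_fin !dotpE; lra.
apply: (closed_fun_limit f g) => // e e0.
pose D := (k / 2 * dotp (y - x) (y - x) + delta)%R.
have D0 : (0 <= D)%R.
  by rewrite addr_ge0// mulr_ge0 ?dotp_ge0// divr_ge0// ltW.
(* It is shown below that [n |y - z|^2 <= D]; this [n] then forces [|y - z|^2 <= e]. *)
pose n := ((D + 1) / e)%R.
have n0 : (0 < n)%R by rewrite divr_gt0//; lra.
have [z sz] := prox f g y _ n cf vf pf n0 fm.
have [s fz] := subdifferential_fin f z _ pf sz.
have zm := fm z; rewrite fz lee_fin in zm.
set w := (y - z)%R in sz *; set h := (g + n *: w)%R in sz.
have w0 := dotp_ge0 w.
have zB : (s + dotp g w + n * dotp w w <= B)%R.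
  have := H z x h g s r fz fx sz sx; rewrite -subr_ge0 => H2.
  (* Completing the square: this term absorbs [<h - g, y - x>] into
     [|h - g|^2 / (2 k) + k / 2 |y - x|^2]. *)
  have : (0 <= (2 * k)^-1 *
      dotp (h - g - k *: (y - x)) (h - g - k *: (y - x)))%R.
    by rewrite mulr_ge0 ?dotp_ge0// invr_ge0 mulr_ge0// ltW.
  move=> /(fun H1 => addr_ge0 H1 H2); rewrite /B -(subr_ge0 _ (_ + delta)%R).
  congr (0 <= _)%R.
  rewrite /h /w !dotpE ?(dotpC y g) ?(dotpC z g) ?(dotpC x g) ?(dotpC x y)
    ?(dotpC z y) ?(dotpC x z); field.
  by rewrite gt_eqF.
exists z; rewrite -/w; split.
  (* The minorant [zm] gives [s + <g, w> >= r + <g, y - x>], which is subtracted from [zB]. *)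
  have : (n * dotp w w <= D)%R.
    move: zB zm; rewrite /B /D /w !dotpE; lra.
  rewrite /n mulrAC ler_pdivrMr// => H1.
  have : ((D + 1) * dotp w w <= (D + 1) * e)%R by nra.
  by rewrite ler_pM2l//; lra.
rewrite fz lee_fin.
have : (0 <= n * dotp w w)%R by rewrite mulr_ge0// ltW.
by move: zB; rewrite /w !dotpE; lra.
Qed.

(* A point [g'] of the domain of [f^*] need not be a subgradient of [f]; it is the
   limit as [s -> 0] of the subgradients [h = g' + s^2 (x - z)], with [z] the
   proximal point of [x]. *)
Lemma cocoercive_conjugate f (q delta : R) x g g' (r c : R) : closed_fun f ->
  convex_on setT f -> proper_fun f -> (0 <= q)%R ->
  cocoercive f q delta -> f x = r%:E -> subdifferential f x g ->
  fenchel_conjugate f g' = c%:E ->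
  (dotp g' x - r + q * dotp (g - g') (g - g') - delta <= c)%R.
Proof.
move=> cf vf pf q0 H fx sx fg'.
have fm : forall y, (- c + dotp g' y)%:E <= f y.
  by apply: conjugate_minorant; rewrite fg'.
rewrite -subr_ge0; set N := dotp (g - g')%R (g - g')%R.
apply: (@ge0_lim _ _ (q * (N + (r - dotp g' x + c)))) => s s0 s1.
have ss0 : (0 < s ^+ 2)%R by rewrite exprn_gt0.
have [z sz] := prox f g' x _ (s ^+ 2)%R cf vf pf ss0 fm.
have [t fz] := subdifferential_fin f z _ pf sz.
set h := (g' + _)%R in sz.
(* With the parameter [s^2], [h = g' + s v] where [|v|^2] is bounded independently of [s] ([vC]), so
   [h] differs from [g'] by a term of order [s]. *)
pose v := (s *: (x - z))%R.
have zm := fm z; rewrite fz lee_fin in zm.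
have xz := subdifferentialP f z h t x fz sz; rewrite fx lee_fin in xz.
have vE : dotp v v = (s ^+ 2 * dotp (x - z) (x - z))%R.
  by rewrite /v dotpZl dotpZr mulrA expr2.
have hE u : dotp h u = (dotp g' u + s * dotp v u)%R.
  by rewrite /h /v dotpDl !dotpZl mulrA expr2.
have hxz : dotp h (x - z)%R = (dotp g' x - dotp g' z + dotp v v)%R.
  by rewrite vE /h dotpDl dotpZl !(dotpDr g') dotpNr.
have vC : (dotp v v <= r - dotp g' x + c)%R by rewrite hxz in xz; lra.
have := H z x h g t r fz fx sz sx; rewrite hxz.
have -> : (g - h = (g - g') - s *: v)%R.
  by rewrite /h /v scalerA -expr2 opprD addrA.
rewrite dotp_subZ -/N; set u := (g - g')%R in N *.
have uv : (2 * dotp u v <= N + dotp v v)%R by exact: dotp_mul2_le.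
have v0 := dotp_ge0 v => H1.
have : (q * (N - s * (N + (r - dotp g' x + c))) <=
   q * (N + s ^+ 2 * dotp v v - 2 * s * dotp u v))%R.
  apply: ler_wpM2l => //.
  have : (s * (2 * dotp u v) <= s * (N + (r - dotp g' x + c)))%R.
    by rewrite ler_pM2l//; lra.
  have : (0 <= s ^+ 2 * dotp v v)%R by rewrite mulr_ge0// ltW.
  lra.
lra.
Qed.

End smoothness.

(** * The circle of implications 1, 2, 3, 1, argued separately for each [delta] *)

Theorem lemma2p4 (R : realType) (d : nat) (f : 'rV[R]_d -> \bar R)
    (L : R -> \bar R)
    (f_closed : closed_fun f) (f_convex : convex_on setT f)
    (f_proper : proper_fun f) (L_isf : inexact_smoothness_function L) :
  [<-> (forall (delta : R) (x y gx gy : 'rV[R]_d),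
          (0 <= delta)%R -> subdifferential f x gx -> subdifferential f y gy ->
          f x + (dotp gx (y - x)%R)%:E
            + (2%:E * L delta)^-1 * (enorm (gy - gx)%R ^+ 2)%:E
            - delta%:E <= f y);
       inexactly_smooth L f;
       inexactly_strongly_convex (fun delta => (L delta)^-1)
         (fenchel_conjugate f)].
Proof.
pose Q (delta q : R) := [/\ (0 <= q)%R, (2%:E * L delta)^-1 = q%:E,
  (L delta)^-1 / 2%:E = q%:E &
  L delta < +oo ->
    exists k : R, [/\ L delta = k%:E, (0 < k)%R & q = (2 * k)^-1%R]].
have LQ delta : (0 <= delta)%R -> exists q, Q delta q.
  by move=> d0; apply: inv_smoothness_fin; exact: isf_gt0.
have cocoP : (forall (delta : R) (x y gx gy : 'rV[R]_d),
      (0 <= delta)%R -> subdifferential f x gx -> subdifferential f y gy ->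
      f x + (dotp gx (y - x)%R)%:E
        + (2%:E * L delta)^-1 * (enorm (gy - gx)%R ^+ 2)%:E
        - delta%:E <= f y) <->
    (forall delta q, (0 <= delta)%R -> Q delta q -> cocoercive f q delta).
  split=> [H delta q d0 [_ qE _ _] x y gx gy r s fx fy sx sy|].
    have := H delta x y gx gy d0 sx sy.
    by rewrite qE fx fy enorm_sqr -EFinM -!EFinD lee_fin.
  move=> H delta x y gx gy d0 sx sy; have [q qQ] := LQ _ d0.
  have [r fx] := subdifferential_fin f x gx f_proper sx.
  have [s fy] := subdifferential_fin f y gy f_proper sy.
  have := H delta q d0 qQ x y gx gy r s fx fy sx sy.
  by case: qQ => _ -> _ _; rewrite fx fy enorm_sqr -EFinM -!EFinD lee_fin.
tfae.
- move=> /cocoP H; split => // x y g delta sx d0 Lfin.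
  have [q qQ] := LQ _ d0; have [_ _ _ /(_ Lfin)[k [Lk k0 qk]]] := qQ.
  have [r fx] := subdifferential_fin f x g f_proper sx.
  have Hq := H delta q d0 qQ; rewrite qk in Hq.
  rewrite Lk fx enorm_sqr inver pnatr_eq0/= -!EFinM -!EFinD.
  exact: (cocoercive_smooth f k delta x y g r).
- move=> [_ H].
  have {}H delta q : (0 <= delta)%R -> Q delta q -> cocoercive f q delta.
    (* Where [L delta = +oo], condition 2 is silent, but [q = 0] and cocoercivity is the subgradient
       inequality weakened by [delta]. *)
    move=> d0 [q0 q1 _ qk]; have [Lfin|] := ltP (L delta) +oo; last first.
      rewrite leye_eq => /eqP Ly; move: q1.
      rewrite Ly gt0_muley ?lte_fin// invey => -[<-] x y gx gy r s fx fy sx _.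
      by have := subdifferentialP f x gx r y fx sx; rewrite fy lee_fin; lra.
    have [k [Lk k0 ->]] := qk Lfin.
    apply: smooth_cocoercive => // x y g r fx sx.
    have := H x y g delta sx d0 Lfin.
    by rewrite Lk fx enorm_sqr inver pnatr_eq0/= -!EFinM -!EFinD.
  split; first exact: convex_conjugate.
  move=> g g' x delta sg d0.
  case fg' : (fenchel_conjugate f g') => [c||]; last 2 first.
  + by rewrite leey.
  + by have := conjugate_gtNy f g' f_proper; rewrite fg' ltxx.
  have [b fg] : exists b : R, fenchel_conjugate f g = b%:E.
    have := sg g'; have := conjugate_gtNy f g f_proper.
    by rewrite fg'; case: (fenchel_conjugate f g) => // b; exists b.
  have sx := conjugate_subdifferentialK f g x b f_closed f_convex
    f_proper fg sg.
  have [r fx] := subdifferential_fin f x g f_proper sx.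
  have [q qQ] := LQ _ d0; have [q0 _ -> _] := qQ.
  have := cocoercive_conjugate f q delta x g g' r c f_closed f_convex
    f_proper q0
    (H delta q d0 qQ) fx sx fg'.
  rewrite (conjugate_subdifferential f g x r)// enorm_sqr -EFinM -!EFinD.
  by rewrite lee_fin !(dotpDr x) dotpNr (dotpC x g) (dotpC x g'); lra.
- move=> [_ H]; apply/cocoP => delta q d0 [_ _ qE _] x y gx gy r s fx fy sx sy.
  (* The roles swap: [y] is a subgradient of the conjugate at [gy], and Fenchel-Young equality at
     both points turns conjugate values back into [r] and [s]. *)
  have := H gy gx y delta (subdifferential_conjugate f gy y s fy sy) d0.
  rewrite qE (conjugate_subdifferential f gx x r)//.
  rewrite (conjugate_subdifferential f gy y s)// enorm_sqr.
  rewrite -EFinM -!EFinD lee_fin (dotpDr y) (dotpDr gx) !dotpNr.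
  by rewrite (dotpC y gx) (dotpC y gy); lra.
Qed.
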